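(* Let $\bar{\mathsf F}=1_{m\times n}$ and $B=I_n$ (so $m=n$). Let $\hat X\in\mathbb C^{n\times n}$ be non-singular and $\hat F=\hat X\Lambda\hat X^{-1}-A$ (a real matrix), i.e. $(A+\hat F)\hat X=\hat X\Lambda$. Then the conditions $$\hat F=-\hat L\hat X^{\mathsf T},\qquad (A+\hat F)\hat X=\hat X\Lambda,\qquad (A+\hat F)^{\mathsf T}\hat L=\hat L\Lambda$$ (for some matrix $\hat L\in\mathbb C^{n\times n}$) are equivalent to the normal equation $$\langle\hat F,\mathcal T_{\mathcal M}(\hat X)\rangle_F=0,$$ i.e. $\hat F$ is orthogonal to every element of $\mathcal T_{\mathcal M}(\hat X)$.
   Context: $A\in\mathbb R^{n\times n}$; $\Lambda=\mathrm{diag}(\lambda_1,\dots,\lambda_n)$ where $\{\lambda_1,\dots,\lambda_n\}\subset\mathbb C$ is closed under complex conjugation; columns of $\hat X$ and $\hat L$ belonging to conjugate eigenvalues are conjugate. $\bar{\mathsf F}$ is the binary sparsity pattern of the feedback; $\bar{\mathsf F}=1_{m\times n}$ (all ones) means no sparsity constraint. The underlying problem is $\min_X\frac12\|A-X\Lambda X^{-1}\|_F^2$. $R(X)=X\Lambda X^{-1}$ and $\mathcal M=\{R(X):X\text{ non-singular}\}$; $\mathcal T_{\mathcal M}(X)$ denotes the tangent space of $\mathcal M$ at (the point $R(X)$ given by) $X$, i.e. the space of first-order variations of $R$ at $X$: $\mathcal T_{\mathcal M}(X)=\{Y\Lambda X^{-1}-X\Lambda X^{-1}YX^{-1}:Y\in\mathbb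 C^{n\times n}\}$. $\langle M,N\rangle_F=\mathrm{tr}(M^{\mathsf T}N)$ is the Frobenius inner product (with $M=\hat F$ real). *)

(* Defs.v *)
From mathcomp Require Export all_boot all_order all_fingroup all_algebra.
From mathcomp Require Export reals complex.

Set Implicit Arguments.
Unset Strict Implicit.
Unset Printing Implicit Defensive.

Import GRing.Theory.
Local Open Scope ring_scope.

Section Defs.
Variables (R : realType) (n : nat).

Definition cplx (M : 'M[R]_n) : 'M[R[i]]_n := map_mx (fun x => x%:C%C) M.

(* The eigenvalues are listed with multiplicity. They are closed under
   conjugation when some permutation s of the indices sends each eigenvalue to
   its conjugate; s also records which columns belong to conjugate eigenvalues,
   which the eigenvalues alone do not determine when they are repeated. *)
Definition conj_closed (s : 'S_n) (lambda : 'rV[R[i]]_n) : Prop :=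
  forall i, lambda 0 (s i) = (lambda 0 i)^*%C.

Definition conj_cols (s : 'S_n) (X : 'M[R[i]]_n) : Prop :=
  forall i j, X i (s j) = (X i j)^*%C.

Definition Rmap (lambda : 'rV[R[i]]_n) (X : 'M[R[i]]_n) : 'M[R[i]]_n :=
  X *m diag_mx lambda *m invmx X.

(* Tangent space, at the point Rmap lambda X, of the set of values of
   Rmap lambda on non-singular matrices: the values of the differential of
   Rmap lambda at X. *)
Definition tangent (lambda : 'rV[R[i]]_n) (X T : 'M[R[i]]_n) : Prop :=
  exists Y : 'M[R[i]]_n,
    T = Y *m diag_mx lambda *m invmx X
        - X *m diag_mx lambda *m invmx X *m Y *m invmx X.

(* No conjugation: the left argument is meant to be a real matrix. *)
Definition frob (M N : 'M[R[i]]_n) : R[i] := \tr (M^T *m N).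

End Defs.

(* Main.v *)
(* Put G = A + F = X Lambda X^-1 and Z = Y X^-1.  The tangent vectors at X are
   exactly the commutators Z G - G Z, and tr (F^T (Z G - G Z)) =
   tr ((G F^T - F^T G) Z), so F is orthogonal to all of them iff F commutes
   with G^T.  On the other side, F = - L X^T forces L = - F X^-T, and since
   G^T = X^-T Lambda X^T the equation G^T L = L Lambda again says that F
   commutes with G^T. *)
Require Import Defs.

Import GRing.Theory.
Local Open Scope ring_scope.

(** The trace pairing is nondegenerate: against the matrix unit [delta_mx j i] it reads off the
    entry [W i j]. *)
Lemma mxtrace_mul_eq0 (K : comNzRingType) (m n : nat) (W : 'M[K]_(m, n)) :
  (forall Z, \tr (W *m Z) = 0) -> W = 0.
Proof.
move=> W0; apply/matrixP => i j; rewrite mxE -(W0 (delta_mx j i)) /mxtrace.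
rewrite (bigD1 i) //= big1 => [|k /negPf neq_ki]; last first.
  by rewrite mxE big1 // => l _; rewrite mxE neq_ki andbF mulr0.
rewrite addr0 mxE (bigD1 j) //= big1 => [|k /negPf neq_kj].
  by rewrite mxE !eqxx mulr1 addr0.
by rewrite mxE neq_kj mulr0.
Qed.

Section NormalEquation.
Set Implicit Arguments.
Unset Strict Implicit.
Variables (R : realType) (n : nat).
Implicit Types (G F Z X L W : 'M[R[i]]_n) (M : 'M[R]_n).
Implicit Types (lambda : 'rV[R[i]]_n) (s : 'S_n).

Lemma frob_commutator F G Z :
  frob F (Z *m G - G *m Z) = \tr ((G *m F^T - F^T *m G) *m Z).
Proof.
rewrite /frob mulmxBr mulmxBl !raddfB /= !mulmxA; congr (_ - _).
by rewrite mxtrace_mulC mulmxA.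
Qed.

Lemma orthogonal_commutators F G :
  (forall Z, frob F (Z *m G - G *m Z) = 0) <-> G^T *m F = F *m G^T.
Proof.
split=> [F0 | comm_FG Z].
  have /mxtrace_mul_eq0/eqP : forall Z, \tr ((G *m F^T - F^T *m G) *m Z) = 0.
    by move=> Z; rewrite -frob_commutator.
  (* Transposing turns commutation of [G] with [F^T] into commutation of [G^T] with [F]. *)
  rewrite subr_eq0 => /eqP/(congr1 trmx).
  by rewrite !trmx_mul !trmxK.
rewrite frob_commutator; have := congr1 trmx comm_FG.
by rewrite !trmx_mul !trmxK => ->; rewrite subrr mul0mx mxtrace0.
Qed.

(** The substitution [Y = Z *m X] is a bijection on matrices because [X] is invertible. *)
Lemma tangentP lambda X T : X \in unitmx ->
  tangent lambda X T <->
  exists Z, T = Z *m Rmap lambda X - Rmap lambda X *m Z.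
Proof.
move=> X_unit; split=> [[Y ->] | [Z ->]].
  by exists (Y *m invmx X); rewrite /Rmap !mulmxA mulmxKV.
by exists (Z *m X); rewrite /Rmap !mulmxA mulmxK.
Qed.

(** Right multiplication by the invertible [X^T] links the two equations, since [X^T *m (Rmap lambda
    X)^T = diag_mx lambda *m X^T]. *)
Lemma left_eigenvectorsP lambda X L : X \in unitmx ->
  (Rmap lambda X)^T *m L = L *m diag_mx lambda <->
  (Rmap lambda X)^T *m (L *m X^T) = L *m X^T *m (Rmap lambda X)^T.
Proof.
move=> X_unit; have XT_unit : X^T \in unitmx by rewrite unitmx_tr.
have -> : L *m X^T *m (Rmap lambda X)^T = L *m diag_mx lambda *m X^T.
  by rewrite /Rmap !trmx_mul trmx_inv tr_diag_mx !mulmxA mulmxK.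
rewrite mulmxA; split=> [-> // | /(congr1 (mulmx^~ (invmx X^T)))].
by rewrite !mulmxK.
Qed.

(** In this form the condition can be carried through products, as [col_perm s] is right
    multiplication by a permutation matrix. *)
Lemma conj_colsE s X :
  conj_cols s X <-> map_mx (@conjc R) X = col_perm s X.
Proof.
split=> [Xs | /matrixP Xs i j].
  by apply/matrixP => i j; rewrite !mxE Xs.
by have := Xs i j; rewrite !mxE.
Qed.

(** With [P = perm_mx s], conjugating the real product gives [conj(L) P X^T = L X^T]; cancelling
    [X^T] leaves [conj(L) = L P^-1], which is [col_perm s L]. *)
Lemma conj_cols_real_factor s X L M : X \in unitmx -> conj_cols s X ->
  L *m X^T = cplx M -> conj_cols s L.
Proof.
move=> X_unit /conj_colsE Xs LX; apply/conj_colsE.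
have XT_unit : X^T \in unitmx by rewrite unitmx_tr.
have conj_LX : map_mx (@conjc R) L *m (col_perm s X)^T = L *m X^T.
  rewrite -Xs map_trmx -map_mxM LX.
  by apply/matrixP => i j; rewrite !mxE; exact: conjc_real.
rewrite col_permE trmx_mul tr_perm_mx invgK mulmxA in conj_LX.
rewrite -[L in RHS](mulmxK XT_unit) -conj_LX mulmxK // col_permE.
by rewrite -mulmxA -perm_mxM mulgV perm_mx1 mulmx1.
Qed.

End NormalEquation.

Theorem lemma8 (R : realType) (n : nat) (A F : 'M[R]_n)
    (lambda : 'rV[R[i]]_n) (s : 'S_n) (X : 'M[R[i]]_n)
    (lambdaP : conj_closed s lambda)
    (X_cols : conj_cols s X)
    (X_unit : X \in unitmx)
    (defF : cplx F = Rmap lambda X - cplx A) :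
  (exists L : 'M[R[i]]_n,
     [/\ conj_cols s L,
         cplx F = - (L *m X^T),
         cplx (A + F) *m X = X *m diag_mx lambda
       & (cplx (A + F))^T *m L = L *m diag_mx lambda])
  <->
  (forall T : 'M[R[i]]_n, tangent lambda X T -> frob (cplx F) T = 0).
Proof.
have defG : cplx (A + F) = Rmap lambda X.
  by rewrite /cplx map_mxD -!/(cplx _) defF addrC subrK.
rewrite defG; set G := Rmap lambda X.
have orthF : (forall T, tangent lambda X T -> frob (cplx F) T = 0) <->
             G^T *m cplx F = cplx F *m G^T.
  rewrite -orthogonal_commutators; split=> F0 T.
    by apply: F0; apply/tangentP => //; exists T.
  by move=> /(tangentP _ _ X_unit)[Z ->].
rewrite orthF; split=> [[L [_ -> _ /(left_eigenvectorsP _ _ X_unit) LG]] | FG].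
  by rewrite mulmxN mulNmx LG.
have XT_unit : X^T \in unitmx by rewrite unitmx_tr.
pose L := - cplx F *m invmx X^T.
have LX : L *m X^T = - cplx F by rewrite mulmxKV.
exists L; split.
(* The columns of [L] inherit their conjugate pairing from those of [X], because [L *m X^T] is the
   real matrix [- F]. *)
- apply: (@conj_cols_real_factor _ _ _ X _ (- F)) => //.
  by rewrite LX /cplx map_mxN.
- by rewrite LX opprK.
- by rewrite /G /Rmap mulmxKV.
- by apply/left_eigenvectorsP => //; rewrite LX mulmxN mulNmx FG.
Qed.
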